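(* Let $\mathbb P$ be an arbitrary (finite or infinite) partition and let $\overline P:\mathcal A(\mathbb P)\to\mathbb R$ be the upper probability of a Horizontal Barrier Model. Then $\overline P$ is a coherent upper probability on $\mathcal A(\mathbb P)$ if and only if it is subadditive, i.e. $\overline P(A\vee B)\le\overline P(A)+\overline P(B)$ for all $A,B\in\mathcal A(\mathbb P)$.
   Context: A partition $\mathbb P$ is a set of pairwise disjoint non-impossible events (atoms) whose logical sum is the sure event $\Omega$. $\mathcal A(\mathbb P)$ is the powerset of $\mathbb P$ (events are identified with sets of atoms); $\emptyset$ is the impossible event, $\vee$ is union. A probability on $\mathcal A(\mathbb P)$ is a finitely additive function $P_0:\mathcal A(\mathbb P)\to[0,1]$ with $P_0(\Omega)=1$ (no countable additivity is required). A Horizontal Barrier Model (HBM) is a pair $(\underline P,\overline P)$ of maps $\mathcal A(\mathbb P)\to\mathbb R$ determined by a probability $P_0$ on $\mathcal A(\mathbb P)$ and reals $a$, $b>0$ with $a+b>1$ and $b+2a\le 1$ (hence $a<0$, $b>1$), with $c=1-(a+b)<0$: for all $A\in\mathcal A(\mathbb P)\setminus\{\emptyset,\Omega\}$, $\underline P(A)=\min\{\max\{bP_0(A)+a,0\},1\}$ and $\overline P(A)=\max\{\min\{bP_0(A)+c,1\},0\}$, while $\underline P(\emptyset)=\overline P(\emptyset)=0$ and $\underline P(\Omega)=\overline P(\Omega)=1$. $\overline P:\mathcal A(\mathbb P)\to\mathbb R$ is a coherent upper probability if for all $n\in\mathbb N$ ($\mathbb N$ includes $0$), $s_i\ge 0$,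 $A_i\in\mathcal A(\mathbb P)$ ($i=0,\dots,n$), $\max\big[\sum_{i=1}^n s_i(\overline P(A_i)-I_{A_i})-s_0(\overline P(A_0)-I_{A_0})\big]\ge 0$, where $I_A$ is the indicator of $A$ and the maximum is over atoms. *)

(* Defs.v *)
From mathcomp Require Export all_boot all_order all_algebra.
From mathcomp Require Export all_classical reals numfun.

Set Implicit Arguments.
Unset Strict Implicit.
Unset Printing Implicit Defensive.

Import Order.TTheory GRing.Theory Num.Theory.
Local Open Scope classical_set_scope.
Local Open Scope ring_scope.

(* A partition is given by the type T of its
   atoms, with no finiteness, countability or choice structure on T. Events are
   sets of atoms: set0 is the impossible event and setT the sure event. *)

Definition fa_probability (R : realType) (T : Type) (P : set T -> R) : Prop :=
  [/\ forall A, 0 <= P A <= 1,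
      forall A B, A `&` B = set0 -> P (A `|` B) = P A + P B
    & P setT = 1].

(* The empty and the sure event are treated apart, because the barrier formulas
   need not give the values 0 and 1 there. *)
Definition horizontal_barrier_model (R : realType) (T : Type)
    (Plow Pup : set T -> R) : Prop :=
  exists (P0 : set T -> R) (a b : R),
    let c := 1 - (a + b) in
    [/\ fa_probability P0,
        [/\ 0 < b, 1 < a + b & b + 2 * a <= 1],
        forall A, A <> set0 -> A <> setT ->
          Plow A = Num.min (Num.max (b * P0 A + a) 0) 1 /\
          Pup A = Num.max (Num.min (b * P0 A + c) 1) 0,
        Plow set0 = 0 /\ Pup set0 = 0
      & Plow setT = 1 /\ Pup setT = 1].

Definition is_max (R : realType) (T : Type) (f : T -> R) (m : R) : Prop :=
  range f m /\ ubound (range f) m.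

(* The bet with index 0 is kept apart from the n other ones, which are indexed
   by 'I_n; n = 0 is allowed. *)
Definition coherent_gain (R : realType) (T : Type) (Pup : set T -> R) (n : nat)
    (s0 : R) (A0 : set T) (s : 'I_n -> R) (A : 'I_n -> set T) (w : T) : R :=
  \sum_(i < n) s i * (Pup (A i) - \1_(A i) w) - s0 * (Pup A0 - \1_A0 w).

Definition coherent_upper_probability (R : realType) (T : Type)
    (Pup : set T -> R) : Prop :=
  forall (n : nat) (s0 : R) (A0 : set T) (s : 'I_n -> R) (A : 'I_n -> set T),
    0 <= s0 -> (forall i, 0 <= s i) ->
    exists2 m, is_max (coherent_gain Pup s0 A0 s A) m & 0 <= m.

(* Main.v *)
Require Import Defs.
From mathcomp Require Import lra.

Set Implicit Arguments.
Unset Strict Implicit.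
Unset Printing Implicit Defensive.

Import Order.TTheory GRing.Theory Num.Theory.
Local Open Scope classical_set_scope.
Local Open Scope ring_scope.

(** Why subadditivity suffices. Since [c < 0], the barrier formula is strictly
    superadditive on disjoint events of positive upper probability as long as
    no truncation at 1 occurs. Subadditivity can therefore survive only if the union of two disjoint
    events of positive upper probability is already truncated: it has upper
    probability 1, and the two upper probabilities add up to at least 1
    ([barrier_disjoint_saturation]). An upper probability with this property is
    very rigid. Only finitely many events occur in a gain, and they cut the
    partition into finitely many cells; an event that is a union of cells has
    upper probability 0, that of its unique non-null cell, or 1, according to
    whether it contains no, one, or at least two non-null cells.

    For coherence it is enough that each event [A0] be given at least its upper
    probability by some probability that is dominated on the other events. Two
    point masses achieve this: [p] at a point [x] of a non-null cell, with [p]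
    the upper probability of that cell, and [1 - p] at a point [y] of another
    non-null cell if there is one; otherwise [p = 1]. When [A0] is not null,
    [x] is taken in [A0], and so is [y] when possible ([two_point_domination],
    [two_point_attains]). The expectation of the gain under these masses is
    nonnegative, hence so is the gain at [x] or at [y]; as the gain is constant
    on cells it has a maximum.

    Conversely, subadditivity is the instance of coherence with unit stakes on
    [A] and [B] against [A `|` B], because the indicator of a union is at most
    the sum of the indicators. *)

(** * Upper probabilities saturated by disjoint non-null events *)

Definition disjoint_saturating {R : realType} {T : Type} (u : set T -> R) :=
  forall A B, A `&` B = set0 -> 0 < u A -> 0 < u B ->
    u (A `|` B) = 1 /\ 1 <= u A + u B.

Definition normalized_capacity {R : realType} {T : Type} (u : set T -> R) :=
  [/\ u set0 = 0, u setT = 1 & forall A B, A `<=` B -> u A <= u B].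

Definition subadditive {R : realType} {T : Type} (u : set T -> R) :=
  forall A B : set T, u (A `|` B) <= u A + u B.

Definition cell {T : Type} {S : finType} (sigma : T -> S) (x : T) : set T :=
  [set w | sigma w = sigma x].

Definition union_of_cells {T : Type} {S : finType} (sigma : T -> S)
    (A : set T) : Prop :=
  forall x, A x -> cell sigma x `<=` A.

Lemma capacity_ge0 (R : realType) (T : Type) (u : set T -> R) (A : set T) :
  normalized_capacity u -> 0 <= u A.
Proof. by case=> u0 _ um; rewrite -u0; apply: um. Qed.

Lemma capacity_le1 (R : realType) (T : Type) (u : set T -> R) (A : set T) :
  normalized_capacity u -> u A <= 1.
Proof. by case=> _ u1 um; rewrite -u1; apply: um. Qed.

(** Only finitely many cells are involved, so finite subadditivity applies even
    though the event may be infinite. *)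
Lemma null_of_null_cells (R : realType) (T : Type) (S : finType)
    (sigma : T -> S) (u : set T -> R) (B : set T) :
  normalized_capacity u -> subadditive u ->
  (forall w, B w -> u (cell sigma w) <= 0) -> u B <= 0.
Proof.
move=> cu su nB; have [u0 _ um] := cu.
have part (r : seq S) : u (B `&` [set w | sigma w \in r]) <= 0.
  elim: r => [|s r IHr].
    rewrite (_ : B `&` _ = set0) ?u0//.
    by apply/seteqP; split => w //= -[].
  have us : u (B `&` [set w | sigma w = s]) <= 0.
    have [[w [Bw ws]]|none] := pselect (exists w, B w /\ sigma w = s).
      apply: le_trans (nB w Bw); apply: um => v [_ /= vs].
      by rewrite /cell /= vs ws.
    rewrite (_ : B `&` _ = set0) ?u0//.
    by apply/seteqP; split => w //= -[Bw ws]; apply: none; exists w.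
  have sub : B `&` [set w | sigma w \in s :: r] `<=`
     (B `&` [set w | sigma w = s]) `|` (B `&` [set w | sigma w \in r]).
    by move=> w [Bw] /=; rewrite in_cons => /orP[/eqP|] ?; [left|right].
  by apply: le_trans (um _ _ sub) _; apply: le_trans (su _ _) _; lra.
apply: le_trans (part (enum S)); apply: um => w Bw; split => //=.
by rewrite mem_enum.
Qed.

Lemma exists_nonnull_cell (R : realType) (T : Type) (S : finType)
    (sigma : T -> S) (u : set T -> R) (B : set T) :
  normalized_capacity u -> subadditive u -> 0 < u B ->
  exists2 w, B w & 0 < u (cell sigma w).
Proof.
move=> cu su uB; apply: contrapT => none.
suff : u B <= 0 by lra.
apply: (null_of_null_cells (sigma := sigma) cu su) => w Bw; rewrite leNgt; apply/negP => uw.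
by apply: none; exists w.
Qed.

(** An event exceeding one of its cells in upper probability has another
    non-null cell: null cells add nothing. *)
Lemma exists_other_nonnull_cell (R : realType) (T : Type) (S : finType)
    (sigma : T -> S) (u : set T -> R) (B : set T) (x : T) :
  normalized_capacity u -> subadditive u -> u (cell sigma x) < u B ->
  exists w, [/\ B w, sigma w <> sigma x & 0 < u (cell sigma w)].
Proof.
move=> cu su lt_xB; have [_ _ um] := cu.
have uD : 0 < u (B `\` cell sigma x).
  have sub : B `<=` cell sigma x `|` (B `\` cell sigma x).
    by move=> w Bw; case: (pselect (cell sigma x w)) => ?; [left|right].
  by have := um _ _ sub; have := su (cell sigma x) (B `\` cell sigma x); lra.
have [w [Bw xw] uw] := exists_nonnull_cell sigma cu su uD.
by exists w.
Qed.

(** * Two-point probabilities *)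

(** If both points lie in [A], then [A] contains two non-null cells, unless one
    cell already has upper probability 1; either way [u A = 1]. If only [y]
    does, its mass [1 - u (cell sigma x)] fits because the upper probabilities
    of two disjoint non-null cells add up to at least 1. *)
Lemma two_point_domination (R : realType) (T : Type) (S : finType)
    (sigma : T -> S) (u : set T -> R) (x y : T) (A : set T) :
  normalized_capacity u -> disjoint_saturating u ->
  0 < u (cell sigma x) ->
  u (cell sigma x) = 1 \/ (sigma y <> sigma x /\ 0 < u (cell sigma y)) ->
  union_of_cells sigma A ->
  u (cell sigma x) * \1_A x + (1 - u (cell sigma x)) * \1_A y <= u A.
Proof.
move=> cu du ux hy cA; have [_ _ um] := cu.
have uA0 := capacity_ge0 A cu; have ux1 := capacity_le1 (cell sigma x) cu.
have pair : sigma y <> sigma x /\ 0 < u (cell sigma y) ->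
    u (cell sigma x `|` cell sigma y) = 1 /\
    1 <= u (cell sigma x) + u (cell sigma y).
  move=> [xy uy]; apply: du => //.
  by apply/seteqP; split => w //=; rewrite /cell /= => -[-> /esym].
rewrite !indicE.
case: (boolP (x \in A)) => [/set_mem xA|_];
  case: (boolP (y \in A)) => [/set_mem yA|_]; rewrite ?mulr1 ?mulr0; last by lra.
- case: hy => [x1|/pair[xy1 _]]; first by have := um _ _ (cA x xA); lra.
  suff : u (cell sigma x `|` cell sigma y) <= u A by lra.
  by apply: um => w [] ?; [apply: (cA x xA)|apply: (cA y yA)].
- by have := um _ _ (cA x xA); lra.
- case: hy => [->|/pair[_ xy]]; first by lra.
  by have := um _ _ (cA y yA); lra.
Qed.

(** If [A0] contains two non-null cells, both masses are put in it. If it has a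
    single one, that cell carries all of [u A0], so [x] in it suffices and [y]
    is free. If it is null, nothing is required of [x] and [y]. *)
Lemma two_point_attains (R : realType) (T : Type) (S : finType)
    (sigma : T -> S) (u : set T -> R) (A0 : set T) :
  normalized_capacity u -> subadditive u ->
  exists x y : T,
    [/\ 0 < u (cell sigma x),
        u (cell sigma x) = 1 \/ (sigma y <> sigma x /\ 0 < u (cell sigma y))
      & u A0 <= u (cell sigma x) * \1_A0 x + (1 - u (cell sigma x)) * \1_A0 y].
Proof.
move=> cu su; have [_ u1 _] := cu.
have ind_ge0 w : 0 <= \1_A0 w :> R by rewrite indicE ler0n.
have companion x : exists y,
    u (cell sigma x) = 1 \/ (sigma y <> sigma x /\ 0 < u (cell sigma y)).
  have := capacity_le1 (cell sigma x) cu.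
  rewrite le_eqVlt => /orP[/eqP x1|]; first by exists x; left.
  rewrite -[X in _ < X]u1.
  by move=> /(exists_other_nonnull_cell cu su)[y [_ ? ?]]; exists y; right.
have [A0pos|A0null] := ltP 0 (u A0); last first.
  have [x _ ux] : exists2 x, [set: T] x & 0 < u (cell sigma x).
    by apply: (exists_nonnull_cell sigma cu su); rewrite u1.
  have [y hy] := companion x; exists x, y; split => //.
  apply: (le_trans A0null); apply: addr_ge0; apply: mulr_ge0 => //.
    exact: ltW.
  by rewrite subr_ge0; exact: capacity_le1.
have [x A0x ux] := exists_nonnull_cell sigma cu su A0pos.
have ux1 := capacity_le1 (cell sigma x) cu.
have ix : \1_A0 x = 1 :> R by rewrite indicE mem_set.
have [A0small|A0big] := leP (u A0) (u (cell sigma x)).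
  have [y hy] := companion x; exists x, y; split => //; rewrite ix mulr1.
  by rewrite (le_trans A0small)// lerDl mulr_ge0// subr_ge0.
have [y [A0y yx uy]] := exists_other_nonnull_cell cu su A0big.
exists x, y; split => //; first by right.
have -> : \1_A0 y = 1 :> R by rewrite indicE mem_set.
by rewrite ix; have := capacity_le1 A0 cu; lra.
Qed.

(** * Coherence *)

Lemma max_of_constant_on_cells (R : realType) (T : Type) (S : finType)
    (sigma : T -> S) (f : T -> R) (x : T) :
  (forall v w, sigma v = sigma w -> f v = f w) -> exists m, is_max f m.
Proof.
move=> fsigma.
pose g s := xget 0 [set r | exists2 w, sigma w = s & f w = r].
have gE w : g (sigma w) = f w.
  rewrite /g; case: xgetP => [r _ [v vw <-]|/(_ (f w))]; first exact: fsigma.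
  by case; exists w.
have Px : `[< exists w, sigma w = sigma x >] by apply/asboolP; exists x.
case: (@arg_maxP _ _ S _ (fun s => `[< exists w, sigma w = s >]) g Px).
move=> _ /asboolP[w <-] wmax; exists (g (sigma w)); split.
  by exists w.
by move=> _ [v _ <-]; rewrite -(gE v); apply: wmax; apply/asboolP; exists v.
Qed.

Lemma coherent_of_disjoint_saturating (R : realType) (T : Type)
    (u : set T -> R) :
  normalized_capacity u -> subadditive u -> disjoint_saturating u ->
  coherent_upper_probability u.
Proof.
move=> cu su du n s0 A0 s A s0_ge0 s_ge0.
pose sigma w : bool * {ffun 'I_n -> bool} :=
  (`[< A0 w >], [ffun i => `[< A i w >]]).
have A0sigma v w : sigma v = sigma w -> A0 v = A0 w.
  by move=> vw; exact: propext (asbool_eq_equiv (congr1 fst vw)).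
have Asigma i v w : sigma v = sigma w -> A i v = A i w.
  move=> vw; apply: propext; apply: asbool_eq_equiv.
  by have /ffunP/(_ i) := congr1 snd vw; rewrite !ffunE.
have Acells i : union_of_cells sigma (A i).
  by move=> x Aix w /(Asigma i) ->.
have [x [y [ux hy attained]]] := two_point_attains sigma A0 cu su.
have [m [mrange mub]] : exists m, is_max (coherent_gain u s0 A0 s A) m.
  apply: (@max_of_constant_on_cells _ _ _ sigma _ x) => v w vw.
  have ind (B : set T) : B v = B w -> \1_B v = \1_B w :> R.
    move=> vwB; rewrite !indicE; congr (nat_of_bool _)%:R.
    by apply/idP/idP; rewrite !in_setE vwB.
  rewrite /coherent_gain (ind _ (A0sigma _ _ vw)); congr (_ - _).
  by apply: eq_bigr => i _; rewrite (ind _ (Asigma i _ _ vw)).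
exists m; first by split.
set p := u (cell sigma x) in ux hy attained.
have p1 : p <= 1 by exact: capacity_le1.
have gx : coherent_gain u s0 A0 s A x <= m by apply: mub; exists x.
have gy : coherent_gain u s0 A0 s A y <= m by apply: mub; exists y.
(* A weighted mean of two values of the gain is a lower bound for [m]. *)
suff mean : 0 <= p * coherent_gain u s0 A0 s A x
                 + (1 - p) * coherent_gain u s0 A0 s A y.
  by nra.
rewrite /coherent_gain !mulrBr !mulr_sumr addrACA -big_split /= -opprD.
rewrite subr_ge0.
apply: (@le_trans _ _ 0).
  by nra.
apply: sumr_ge0 => i _.
have := @two_point_domination _ _ _ _ _ _ _ (A i) cu du ux hy (Acells i).
rewrite -/p; have := s_ge0 i; nra.
Qed.

(** The bet on [A] and [B] against their union never gains more than
    [u A + u B - u (A `|` B)]. *)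
Lemma subadditive_of_coherent (R : realType) (T : Type) (u : set T -> R) :
  coherent_upper_probability u -> subadditive u.
Proof.
move=> cu A B.
have [] := cu 2%N 1 (A `|` B) (fun=> 1) (fun i => if i == ord0 then A else B).
- exact: ler01.
- by move=> _; exact: ler01.
move=> _ [[w _ <-] _].
rewrite /coherent_gain !big_ord_recl big_ord0 /= !indicE in_setU.
by case: (w \in A); case: (w \in B) => /=; lra.
Qed.

(** * Horizontal barrier models *)

Lemma fa_probability_le (R : realType) (T : Type) (P : set T -> R)
    (A B : set T) :
  fa_probability P -> A `<=` B -> P A <= P B.
Proof.
move=> [P01 Padd _] AB.
rewrite -(setDUK AB) Padd; last by rewrite setDE setICA setICr setI0.
by rewrite lerDl; have /andP[] := P01 (B `\` A).
Qed.

Lemma barrier_normalized_capacity (R : realType) (T : Type)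
    (Plow Pup : set T -> R) :
  horizontal_barrier_model Plow Pup -> normalized_capacity Pup.
Proof.
move=> [P0 [a [b [faP [b0 _ _] barrier [_ u0] [_ u1]]]]].
have Pup01 A : 0 <= Pup A <= 1.
  have [->|A0] := pselect (A = set0); first by rewrite u0 lexx ler01.
  have [->|A1] := pselect (A = setT); first by rewrite u1 lexx ler01.
  have [_ ->] := barrier _ A0 A1.
  by rewrite le_max lexx orbT /= ge_max ge_min lexx orbT ler01.
split=> // A B AB; have /andP[A_ge0 A_le1] := Pup01 A.
have /andP[B_ge0 B_le1] := Pup01 B.
have [A0|A0] := pselect (A = set0); first by rewrite A0 u0.
have [B1|B1] := pselect (B = setT); first by rewrite B1 u1.
have B0 : B <> set0 by move=> B0; apply: A0; rewrite -subset0 -B0.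
have A1 : A <> setT by move=> A1; apply: B1; rewrite -subTset -A1.
have [_ ->] := barrier _ A0 A1; have [_ ->] := barrier _ B0 B1.
have PAB := fa_probability_le faP AB.
have le_bar : b * P0 A + (1 - (a + b)) <= b * P0 B + (1 - (a + b)).
  by rewrite lerD2r ler_pM2l.
rewrite ge_max !le_max lexx !orbT andbT; apply/orP; left.
by rewrite le_min !ge_min le_bar lexx orbT.
Qed.

(** Without truncation the value [b * (P0 A + P0 B) + c] on the union would
    exceed the sum [b * (P0 A + P0 B) + 2 * c] of the values on [A] and [B]. *)
Lemma barrier_disjoint_saturation (R : realType) (T : Type)
    (Plow Pup : set T -> R) :
  horizontal_barrier_model Plow Pup -> subadditive Pup ->
  disjoint_saturating Pup.
Proof.
move=> hbm su A B AB0 uA uB.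
have cu := barrier_normalized_capacity hbm.
have uA1 := capacity_le1 A cu; have uB1 := capacity_le1 B cu.
have uAB1 := capacity_le1 (A `|` B) cu; have sAB := su A B.
suff : Pup (A `|` B) = 1 by move=> e; rewrite e in sAB *.
have [_ uT um] := cu.
have leA : Pup A <= Pup (A `|` B) by apply: um; exact: subsetUl.
have leB : Pup B <= Pup (A `|` B) by apply: um; exact: subsetUr.
have [A1|A1] := eqVneq (Pup A) 1; first by lra.
have [B1|B1] := eqVneq (Pup B) 1; first by lra.
move: hbm => [P0 [a [b [[P01 Padd _] [b0 ab _] barrier [_ u0] _]]]].
have interior C : 0 < Pup C -> Pup C != 1 -> Pup C <= 1 ->
    Pup C = b * P0 C + (1 - (a + b)).
  move=> C_gt0 C_ne1 C_le1.
  have C0 : C <> set0 by move=> e; move: C_gt0; rewrite e u0 ltxx.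
  have C1 : C <> setT by move=> e; move: C_ne1; rewrite e uT eqxx.
  have [_ uC] := barrier _ C0 C1; move: C_gt0 C_ne1; rewrite uC.
  case: (ltP 0 (Num.min _ _)) => _; last by rewrite ltxx.
  by move=> _; case: (ltP (b * P0 C + (1 - (a + b))) 1) => //; rewrite eqxx.
apply/eqP/negPn/negP => AB1.
have uAB := interior _ (lt_le_trans uA leA) AB1 uAB1.
move: sAB; rewrite uAB (interior _ uA A1 uA1) (interior _ uB B1 uB1).
rewrite Padd// mulrDr; lra.
Qed.

Theorem proposition5p5 (R : realType) (T : Type) (Plow Pup : set T -> R)
    (hHBM : horizontal_barrier_model Plow Pup) :
  coherent_upper_probability Pup <->
  (forall A B : set T, Pup (A `|` B) <= Pup A + Pup B).
Proof.
split; first exact: subadditive_of_coherent.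
move=> su; apply: coherent_of_disjoint_saturating => //.
  exact: barrier_normalized_capacity hHBM.
exact: barrier_disjoint_saturation hHBM su.
Qed.
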